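(* Let $m\ge 2$ be an integer, let $H$ be a Hilbert space with $\dim H\ge 2$, let $X$ be a topological linear space, and let $P\colon\mathcal{B}(H)\to X$ be a continuous $m$-homogeneous polynomial. Suppose that $P$ is orthogonally additive on $\mathcal{B}(H)$. Then $P=0$.
   Context: Hilbert spaces are complex; topological linear spaces are complex and Hausdorff. $\mathcal{B}(H)$ is the algebra of all bounded operators on $H$ with the operator norm. Elements $x,y\in\mathcal{B}(H)$ are mutually orthogonal, $x\perp y$, if $xy^*=y^*x=0$. $P$ is orthogonally additive on $\mathcal{B}(H)$ if $P(x+y)=P(x)+P(y)$ whenever $x,y\in\mathcal{B}(H)$ and $x\perp y$. A map $P\colon E\to X$ between linear spaces is an $m$-homogeneous polynomial if there is an $m$-linear map $\varphi\colon E^m\to X$ with $P(x)=\varphi(x,\dots,x)$ for all $x\in E$. *)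

(* Defs.v *)
From HB Require Import structures.
From mathcomp Require Import all_boot all_order all_algebra.
From mathcomp Require Import complex sesquilinear ring lra.
From mathcomp Require Import all_classical all_reals all_analysis.
Import Order.TTheory GRing.Theory Num.Theory Num.Def.
Import numFieldNormedType.Exports.

Set Implicit Arguments.
Unset Strict Implicit.
Unset Printing Implicit Defensive.

Local Open Scope classical_set_scope.
Local Open Scope ring_scope.
Local Open Scope complex_scope.

(* The inner product is linear in its first argument and conjugate-linear in
   the second. As for every normedModType over R[i], norms take their values in
   R[i] itself, where they are nonnegative reals; the order of R[i] is the
   partial order with x <= y iff y - x is a nonnegative real. *)
HB.mixin Record CompleteNormedModule_isHilbert (R : realType) H
    & CompleteNormedModule R[i] H := {
  inner_subdef : {dot H for (@conjC R[i])} ;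
  inner_subproof : forall x : H, inner_subdef x x = `|x| ^+ 2
}.

#[short(type="hilbertType")]
HB.structure Definition Hilbert (R : realType) :=
  {H of CompleteNormedModule R[i] H & CompleteNormedModule_isHilbert R H}.

Definition inner {R : realType} {H : hilbertType R} :
  {dot H for (@conjC R[i])} := inner_subdef.

Lemma innerE {R : realType} {H : hilbertType R} (u : H) :
  inner u u = `|u| ^+ 2.
Proof. exact: inner_subproof. Qed.

Section BoundedLinear.
Context {R : realType} {H : hilbertType R}.

Definition bounded_linear : pred (H -> H) := fun f =>
  `[< linear f /\ exists M : R, forall x, `|f x| <= M%:C * `|x| >].

Lemma bounded_linearP f : reflect
  (linear f /\ exists M : R, forall x, `|f x| <= M%:C * `|x|)
  (f \in bounded_linear).
Proof. exact: asboolP. Qed.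

Lemma bounded_linear_submod : submod_closed bounded_linear.
Proof.
split.
  apply/bounded_linearP; split; first by move=> a u v; rewrite scaler0 addr0.
  by exists 0 => x; rewrite normr0 mul0r.
move=> a f g /bounded_linearP[fl [M fM]] /bounded_linearP[gl [N gN]].
apply/bounded_linearP; split.
  move=> b u v; rewrite !fctE fl gl !scalerDr !scalerA (mulrC b) -!addrA.
  by congr (_ + _); rewrite addrCA.
exists (complex.Re `|a| * M + N) => x; rewrite !fctE.
apply: (le_trans (ler_normD _ _)); rewrite normrZ.
have -> : (complex.Re `|a| * M + N)%:C = `|a| * M%:C + N%:C by rewrite rmorphD rmorphM.
rewrite mulrDl -mulrA.
by rewrite lerD// ler_wpM2l.
Qed.

HB.instance Definition _ :=
  GRing.isSubmodClosed.Build R[i] (H -> H) bounded_linear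
  bounded_linear_submod.

End BoundedLinear.

Record bounded_operator {R : realType} (H : hilbertType R) := BoundedOperator {
  bop_fun :> H -> H ;
  _ : bop_fun \in bounded_linear
}.

Notation "''B(' H )" := (bounded_operator H)
  (at level 8, H at level 2, format "''B(' H )") : type_scope.

Section BoundedOperator.
Context {R : realType} {H : hilbertType R}.
Implicit Types (x y z : 'B(H)) (u v w : H).

HB.instance Definition _ := [isSub for @bop_fun R H].
HB.instance Definition _ := [Choice of 'B(H) by <:].
HB.instance Definition _ := [SubChoice_isSubLmodule of 'B(H) by <:].

Lemma bopP x y : x =1 y -> x = y.
Proof. by move=> xy; apply/val_inj/funext. Qed.

Lemma bop_linear x : linear x.
Proof. by have /bounded_linearP[] := valP x. Qed.

HB.instance Definition _ x :=
  GRing.isLinear.Build R[i] H H *:%R (bop_fun x) (bop_linear x).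

Lemma bop_bounded x : exists M : R, forall u, `|x u| <= M%:C * `|u|.
Proof. by have /bounded_linearP[] := valP x. Qed.

Definition opnorm x : R[i] :=
  (sup [set complex.Re `|x u| | u in [set u | `|u| <= 1]])%:C.

Lemma ReK_norm (V : normedModType R[i]) (u : V) :
  (complex.Re `|u|)%:C = `|u|.
Proof. by rewrite RRe_real// normr_real. Qed.

Lemma opnorm_has_sup x :
  has_sup [set complex.Re `|x u| | u in [set u | `|u| <= 1]].
Proof.
split; first by exists (complex.Re `|x 0|), 0 => //=; rewrite normr0.
have [M xM] := bop_bounded x; exists `|M| => _ [u /= u1 <-].
rewrite -lecR ReK_norm (le_trans (xM u))//.
have [M0|M0] := leP 0 M.
  by rewrite ger0_norm// ler_piMr// ler0c.
by rewrite (@le_trans _ _ 0) ?ler0c// mulr_le0_ge0// lecR ltW.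
Qed.

Lemma opnorm_ge0 x : 0 <= opnorm x.
Proof.
rewrite ler0c; apply: ub_le_sup; first exact: (opnorm_has_sup x).2.
by exists 0; rewrite /= ?linear0 ?normr0.
Qed.

Lemma opnorm_ub x u : `|x u| <= opnorm x * `|u|.
Proof.
have [->|u0] := eqVneq u 0; first by rewrite linear0 !normr0 mulr0.
have nu0 : 0 < `|u| by rewrite normr_gt0.
rewrite -ler_pdivrMr//.
have -> : `|x u| / `|u| = (complex.Re `|x (`|u|^-1 *: u)|)%:C.
  by rewrite ReK_norm linearZ/= normrZ normfV normr_id mulrC.
rewrite lecR; apply: ub_le_sup; first exact: (opnorm_has_sup x).2.
by exists (`|u|^-1 *: u) => //=; rewrite normrZ normfV normr_id mulVf// gt_eqF.
Qed.

Lemma opnorm_le x (M : R[i]) : 0 <= M -> (forall u, `|x u| <= M * `|u|) ->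
  opnorm x <= M.
Proof.
move=> M0 xM; rewrite -(RRe_real (ger0_real M0)) lecR.
apply: ge_sup; first exact: (opnorm_has_sup x).1.
move=> _ [u /= u1 <-]; rewrite -lecR ReK_norm (RRe_real (ger0_real M0)).
by rewrite (le_trans (xM u))// ler_piMr.
Qed.

Lemma opnormD x y : opnorm (x + y) <= opnorm x + opnorm y.
Proof.
apply: opnorm_le => [|u]; first by rewrite addr_ge0// opnorm_ge0.
by rewrite mulrDl (le_trans (ler_normD _ _))// lerD// opnorm_ub.
Qed.

Lemma opnormZ (a : R[i]) x : opnorm (a *: x) = `|a| * opnorm x.
Proof.
have le b z : opnorm (b *: z) <= `|b| * opnorm z.
  apply: opnorm_le => [|u]; first by rewrite mulr_ge0// opnorm_ge0.
  by rewrite normrZ -mulrA ler_wpM2l// opnorm_ub.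
apply/eqP; rewrite eq_le le/=.
have [->|a0] := eqVneq a 0; first by rewrite normr0 mul0r opnorm_ge0.
rewrite -ler_pdivlMl ?normr_gt0// -normfV (le_trans _ (le _ _))//.
by rewrite scalerA mulVf// scale1r.
Qed.

Lemma opnorm0_eq0 x : opnorm x = 0 -> x = 0.
Proof.
move=> x0; apply: bopP => u; apply/eqP; rewrite -normr_le0.
by rewrite (le_trans (opnorm_ub x u))// x0 mul0r.
Qed.

HB.instance Definition _ :=
  Lmodule_isNormed.Build R[i] 'B(H) opnormD opnormZ opnorm0_eq0.

(* From here on, the norm and the topology of 'B(H) are those of opnorm, and
   the product below is the composition of operators. *)
Lemma idop_subproof : (id : H -> H) \in bounded_linear.
Proof. by apply/bounded_linearP; split=> //; exists 1 => u; rewrite mul1r. Qed.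

Definition idop : 'B(H) := BoundedOperator idop_subproof.

Lemma compop_subproof x y : x \o y \in bounded_linear.
Proof.
apply/bounded_linearP; split=> [a u v /=|]; first by rewrite !linearP.
exists (complex.Re (opnorm x * opnorm y)) => u.
rewrite RRe_real ?ger0_real ?mulr_ge0 ?opnorm_ge0//.
by rewrite (le_trans (opnorm_ub _ _))// -mulrA ler_wpM2l ?opnorm_ge0// opnorm_ub.
Qed.

Definition compop x y : 'B(H) := BoundedOperator (compop_subproof x y).

Lemma compopA : associative compop. Proof. by move=> x y z; apply: bopP. Qed.
Lemma compop1l : left_id idop compop. Proof. by move=> x; apply: bopP. Qed.
Lemma compop1r : right_id idop compop. Proof. by move=> x; apply: bopP. Qed.
Lemma compopDl : left_distributive compop +%R.
Proof. by move=> x y z; apply: bopP. Qed.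
Lemma compopDr : right_distributive compop +%R.
Proof. by move=> x y z; apply: bopP => u; exact: (linearD x). Qed.

HB.instance Definition _ := GRing.Zmodule_isPzRing.Build 'B(H)
  compopA compop1l compop1r compopDl compopDr.

Local Notation rn u := (complex.Re `|u|).
Local Notation ip u v := (complex.Re (inner u v)).

Lemma innerC u v : inner u v = (inner v u)^*%C.
Proof. by have := hermC (@inner R H) u v; rewrite expr0 mul1r. Qed.
Lemma innerDl u v w : inner (u + v) w = inner u w + inner v w.
Proof. exact: (linearDl (@inner R H)). Qed.
Lemma innerDr u v w : inner u (v + w) = inner u v + inner u w.
Proof. exact: (linearDr (@inner R H)). Qed.
Lemma innerZl (a : R[i]) u v : inner (a *: u) v = a * inner u v.
Proof. exact: (linearZl_LR (@inner R H)). Qed.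
Lemma innerZr (a : R[i]) u v : inner u (a *: v) = a^*%C * inner u v.
Proof. by rewrite innerC innerZl rmorphM/= -innerC. Qed.

Let ipC u v : ip u v = ip v u.
Proof. by rewrite innerC; case: (inner v u). Qed.
Let ipDl u v w : ip (u + v) w = ip u w + ip v w.
Proof. by rewrite innerDl raddfD. Qed.
Let ipZl (t : R) u v : ip (t%:C *: u) v = t * ip u v.
Proof. by rewrite innerZl; case: (inner u v) => a b/=; rewrite mul0r subr0. Qed.
Let rnE u : rn u ^+ 2 = ip u u.
Proof. by rewrite innerE -ReK_norm -rmorphXn. Qed.
Let rn_ge0 u : 0 <= rn u. Proof. by rewrite -ler0c ReK_norm. Qed.
Let rnD u v : rn (u + v) <= rn u + rn v.
Proof. by rewrite -lecR rmorphD/= !ReK_norm ler_normD. Qed.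
Let ip_le u v : ip u v <= rn u * rn v.
Proof.
have := rnD u v; rewrite -ler_sqr ?nnegrE ?addr_ge0// rnE.
rewrite ipDl !(ipC _ (u + v)) !ipDl -!rnE (ipC v u); lra.
Qed.


Let rn_sum u v : rn (u + v) ^+ 2 = rn u ^+ 2 + rn v ^+ 2 + 2 * ip u v.
Proof. by rewrite rnE ipDl !(ipC _ (u + v)) !ipDl -!rnE (ipC v u); ring. Qed.

Let rnZ (t : R) u : rn (t%:C *: u) ^+ 2 = t ^+ 2 * rn u ^+ 2.
Proof. by rewrite !rnE ipZl ipC ipZl mulrA -expr2. Qed.

Lemma real_riesz (phi : H -> R) (M : R) :
  {morph phi : u v / u + v} -> (forall (t : R) u, phi (t%:C *: u) = t * phi u) ->
  (forall u, phi u <= M * rn u) -> exists w, forall u, phi u = ip u w.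
Proof.
move=> phiD phiZ phiM'.
wlog M0 : M phiM' / 0 <= M.
  apply; [|exact: (normr_ge0 M)] => u.
  by rewrite (le_trans (phiM' u))// ler_wpM2r// ler_norm.
have phiM u : `|phi u| <= M * rn u.
  rewrite ler_norml phiM' andbT lerNl -mulN1r -phiZ (le_trans (phiM' _))//.
  by rewrite rmorphN1 scaleN1r normrN.
pose F u := rn u ^+ 2 - 2 * phi u.
have Fge u : - M ^+ 2 <= F u.
  have := phiM' u; rewrite /F; have := sqr_ge0 (rn u - M); nra.
have F_inf : has_inf (range F).
  by split; [exists (F 0), 0|exists (- M ^+ 2) => _ [u _ <-]].
pose d := inf (range F).
have dF u : d <= F u by apply: (ge_inf F_inf.2); exists u.
have par u v : rn (u - v) ^+ 2 <= 2 * (F u + F v - 2 * d).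
  have := dF ((2^-1)%:C *: (u + v)).
  rewrite /F phiZ phiD rnE ipZl ipC ipZl -rnE rn_sum.
  have -> : rn (u - v) ^+ 2 = rn u ^+ 2 + rn v ^+ 2 - 2 * ip u v.
    have -> : u - v = u + (-1)%:C *: v by rewrite rmorphN1 scaleN1r.
    by rewrite rn_sum (ipC u) ipZl (ipC v) rnZ; ring.
  lra.
pose G := filter_from [set e : R | 0 < e] (fun e => [set u | F u < d + e]).
have GF : ProperFilter G.
  apply: filter_from_proper => [|e e0]; last first.
    have [_ [u _ <-] Fu] := inf_adherent e0 F_inf.
    by exists u.
  apply: filter_from_filter; first by exists 1 => /=.
  move=> e f /= e0 f0; exists (Num.min e f); first by rewrite /= lt_min e0.
  by move=> u /=; rewrite -ltrBlDl lt_min !ltrBlDl => /andP[].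
have Gc : cauchy G.
  apply: cauchy_exP => eps eps0.
  have epsE : (complex.Re eps)%:C = eps by rewrite RRe_real// gtr0_real.
  have r0 : 0 < complex.Re eps by rewrite -ltcR epsE.
  set r := complex.Re eps in epsE r0.
  have e0 : 0 < r ^+ 2 / 8 by rewrite divr_gt0// exprn_gt0.
  have [_ [u _ <-] Fu] := inf_adherent e0 F_inf.
  exists u; exists (r ^+ 2 / 8) => //= v /= Fv.
  rewrite -ball_normE /= -epsE -ReK_norm ltcR -ltr_sqr ?nnegrE ?(ltW r0)//.
  apply: (le_lt_trans (par u v)); move: Fu; rewrite -/d; lra.
have Gcv : cvg G by apply: cauchy_cvg.
have [w Gw] : exists w, G --> w by apply/cvg_ex.
have near_w (e dl : R) : 0 < e -> 0 < dl -> exists2 u, F u < d + e & rn (w - u) < dl.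
  move=> e0 dl0.
  have : nbhs w (ball w dl%:C) by apply: nbhsx_ballx; rewrite ltcR.
  move=> /Gw By; have Ge : G [set u | F u < d + e] by exists e.
  have [u [/= Fu Bu]] := filter_ex (filterI Ge By).
  exists u => //; move: Bu; rewrite -ball_normE /= -ReK_norm.
  by rewrite ltcR.
have Fw : F w <= d.
  apply/ler_addgt0Pl => e e0; set K := 2 * (rn w + M) + 1.
  have K0 : 0 < K by rewrite /K ltr_wpDl// mulr_ge0// addr_ge0.
  have e20 : 0 < e / 2 by rewrite divr_gt0.
  have dl0 : 0 < e / 2 / K by rewrite divr_gt0.
  have [u Fu yu] := near_w _ _ e20 dl0.
  have Kyu : K * rn (w - u) < e / 2 by rewrite mulrC -ltr_pdivlMr.
  have uE : u = w + (-1)%:C *: (w - u) by rewrite rmorphN1 scaleN1r opprB addrCA subrr addr0.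
  have := Fu; rewrite /F {1 2}uE rn_sum phiD phiZ (ipC w) ipZl.
  have := ip_le (w - u) w; have := sqr_ge0 (rn ((-1)%:C *: (w - u))).
  have := phiM (w - u); rewrite ler_norml => /andP[+ _]; have := rn_ge0 (w - u).
  move: Kyu; rewrite /K mulrDl mul1r -mulrA mulrDl => h1 h2 h3 h4 h5 h6.
  rewrite (mulrC (rn (w - u))) in h5; lra.
exists w => u; apply/eqP; rewrite -subr_eq0 -sqrf_eq0 eq_le sqr_ge0 andbT.
set b := phi u - ip u w; pose a := rn u ^+ 2.
have a0 : 0 <= a by rewrite sqr_ge0.
have : forall t : R, 0 <= t ^+ 2 * a - 2 * t * b.
  move=> t; have := le_trans Fw (dF (w + t%:C *: u)).
  rewrite /F rn_sum phiD phiZ (ipC w) ipZl rnZ.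
  by rewrite -/a /b; lra.
move=> /(_ (b / (a + 1))).
have a10 : 0 < a + 1 by rewrite ltr_wpDl.
have -> : (b / (a + 1)) ^+ 2 * a - 2 * (b / (a + 1)) * b =
  - (b ^+ 2 * (a + 2) / (a + 1) ^+ 2) by field; rewrite gt_eqF.
rewrite oppr_ge0 pmulr_lle0 ?invr_gt0 ?exprn_gt0// pmulr_lle0//.
by rewrite ltr_wpDl.
Qed.

Lemma adjoint_subproof x :
  exists y, forall u v, inner (x u) v = inner u (y v).
Proof.
have [M M0 xM] : exists2 M : R, 0 <= M & forall u, rn (x u) <= M * rn u.
  have [M ME] : exists M : R, opnorm x = M%:C by eexists.
  exists M => [|u]; first by rewrite -ler0c -ME opnorm_ge0.
  by rewrite -lecR ReK_norm rmorphM/= ReK_norm -ME opnorm_ub.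
have /choice[y xy] v : exists w, forall u, ip (x u) v = ip u w.
  apply: (@real_riesz _ (M * rn v)) => [u w|t u|u].
  - by rewrite linearD ipDl.
  - by rewrite linearZ ipZl.
  - by rewrite (le_trans (ip_le _ _))// mulrAC ler_wpM2r.
have xyE u v : inner (x u) v = inner u (y v).
  have := xy v ('i%C *: u); rewrite linearZ/= !innerZl.
  have := xy v u; case: (inner (x u) v) => a b; case: (inner u (y v)) => c e /=.
  by rewrite !mul0r !mul1r !sub0r => -> /oppr_inj ->.
have inner_inj u v : (forall w, inner w u = inner w v) -> u = v.
  move=> uv; apply/eqP; rewrite -subr_eq0 -normr_eq0 -sqrf_eq0 -innerE.
  by rewrite innerC innerDl -scaleN1r innerZl mulN1r innerC (innerC v) uv subrr conjc0.
have yP : y \in bounded_linear.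
  apply/bounded_linearP; split=> [a u v|].
    apply: inner_inj => w; rewrite -xyE.
    by rewrite (innerDr (x w)) (innerDr w) 2!innerZr !xyE.
  exists M => v; rewrite -(ReK_norm (y v)) -(ReK_norm v).
  have -> : M%:C * (rn v)%:C = (M * rn v)%:C by rewrite rmorphM.
  rewrite lecR.
  have [->|yv0] := eqVneq (rn (y v)) 0; first by rewrite mulr_ge0.
  have yv_gt0 : 0 < rn (y v) by rewrite lt_neqAle eq_sym yv0 rn_ge0.
  rewrite -(ler_pM2l yv_gt0) -expr2 rnE -xy (le_trans (ip_le _ _))//.
  by rewrite mulrA ler_wpM2r// mulrC.
by exists (BoundedOperator yP).
Qed.

Definition adjoint x : 'B(H) := projT1 (cid (adjoint_subproof x)).

Lemma adjointP x u v : inner (x u) v = inner u (adjoint x v).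
Proof. exact: (projT2 (cid (adjoint_subproof x))). Qed.

End BoundedOperator.

Definition mutually_orthogonal {R : realType} {H : hilbertType R}
  (x y : 'B(H)) : Prop := x * adjoint y = 0 /\ adjoint y * x = 0.

Definition orthogonally_additive {R : realType} {H : hilbertType R}
    {X : zmodType} (P : 'B(H) -> X) : Prop :=
  forall x y : 'B(H), mutually_orthogonal x y -> P (x + y) = P x + P y.

(* Linearity in the i-th argument, the other arguments being those of f. *)
Definition multilinear {K : pzRingType} {E X : lmodType K} {m : nat}
    (phi : ('I_m -> E) -> X) : Prop :=
  forall (i : 'I_m) (f : 'I_m -> E),
    linear (fun v : E => phi (fun j => if j == i then v else f j)).

Definition homogeneous_polynomial {K : pzRingType} {E X : lmodType K}
    (m : nat) (P : E -> X) : Prop :=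
  exists2 phi : ('I_m -> E) -> X, multilinear phi &
    forall x : E, P x = phi (fun=> x).

(* dim V >= n, where dim V may be infinite: there are n linearly independent
   vectors in V. *)
Definition dim_ge {K : pzRingType} (n : nat) (V : lmodType K) : Prop :=
  exists e : 'I_n -> V, forall c : 'I_n -> K,
    \sum_(i < n) c i *: e i = 0 -> forall i, c i = 0.

(* Main.v *)
Require Import Defs.
From HB Require Import structures.
From mathcomp Require Import all_boot all_order all_algebra.
From mathcomp Require Import complex sesquilinear ring lra.
From mathcomp Require Import all_classical all_reals all_analysis.
Import Order.TTheory GRing.Theory Num.Theory Num.Def.
Import numFieldNormedType.Exports.

(* The argument is algebraic, apart from one fact about H. If s * s = 0 then 1
   + l s and 1 - conj(l) s^* are invertible and applying them to x and y
   preserves x _|_ y. Since P is polynomial, l and conj(l) can be made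
   independent of each other, so additivity on orthogonal pairs spreads to
   pairs g x h, g' y h' where (g, h) and (g', h') are unrelated products of
   such factors. For complementary projections e and f, d in the corner of f
   and c : e -> f, b : f -> e, the polynomial P is therefore additive on d and
   t (1 + c) e (1 + b), and as m >= 2 the term of degree one in t vanishes:
   dP_d(c b) = 0. If the identity of f is a sum of products c b then Euler's
   identity gives m P(d) = dP_d(d) = 0. An operator whose corner at e is
   invertible is, by Schur complement, of the form (1 + c) a (1 + b) + d with a
   and d in the two corners, so P vanishes there, in particular at x + t 1 for
   all large t, hence at x.

   The fact about H is that 1 = p + (1 - p) for a projection p such that p and
   1 - p factor through each other: take p = n^* n for a maximal partial
   isometry n with n * n = 0, for which 1 - p - n n^* has rank at most one. *)

Set Implicit Arguments.
Unset Strict Implicit.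
Unset Printing Implicit Defensive.

Local Open Scope classical_set_scope.
Local Open Scope ring_scope.
Local Open Scope complex_scope.

(** * Polynomial functions of one complex variable and multilinear maps *)

Section PolynomialFunctions.
Context {R : realType} {X : lmodType R[i]}.
Implicit Types (F G : R[i] -> X) (n : nat).

(** [n] counts coefficients, so the degree is less than [n]. *)
Definition polyfun n F := exists c : nat -> X,
  forall t, F t = \sum_(k < n) t ^+ k *: c k.

Lemma polyfun_widen n n' F : (n <= n')%N -> polyfun n F -> polyfun n' F.
Proof.
move=> nn' [c Fc]; exists (fun k => if (k < n)%N then c k else 0) => t.
rewrite Fc (big_ord_widen _ (fun k => t ^+ k *: c k) nn') big_mkcond.
by apply: eq_bigr => k _; case: ifP => //; rewrite scaler0.
Qed.

Lemma polyfun_cst n x : polyfun n.+1 (fun=> x).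
Proof.
exists (fun k => if k == 0%N then x else 0) => t.
rewrite big_ord_recl/= scale1r big1 ?addr0// => k _.
by rewrite scaler0.
Qed.

Lemma polyfunD n F G : polyfun n F -> polyfun n G -> polyfun n (fun t => F t +
  G t).
Proof.
move=> [c Fc] [d Gd]; exists (fun k => c k + d k) => t.
by rewrite Fc Gd -big_split; apply: eq_bigr => k _; rewrite scalerDr.
Qed.

Lemma polyfunN n F : polyfun n F -> polyfun n (fun t => - F t).
Proof.
move=> [c Fc]; exists (fun k => - c k) => t.
by rewrite Fc -sumrN; apply: eq_bigr => k _; rewrite scalerN.
Qed.

Lemma polyfunB n F G : polyfun n F -> polyfun n G -> polyfun n (fun t => F t -
  G t).
Proof. by move=> pF pG; apply: polyfunD => //; apply: polyfunN. Qed.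

Lemma polyfun_sum n (J : finType) (F : J -> R[i] -> X) :
  (forall j, polyfun n.+1 (F j)) -> polyfun n.+1 (fun t => \sum_j F j t).
Proof.
move=> pF; have [c Fc] := choice pF.
exists (fun k => \sum_j c j k) => t.
under [RHS]eq_bigr do rewrite scaler_sumr.
by rewrite exchange_big; apply: eq_bigr => j _; rewrite Fc.
Qed.

Lemma polyfunX n F : polyfun n F -> polyfun n.+1 (fun t => t *: F t).
Proof.
move=> [c Fc]; exists (fun k => if k is k'.+1 then c k' else 0) => t.
rewrite big_ord_recl scaler0 add0r Fc scaler_sumr.
by apply: eq_bigr => k _; rewrite scalerA -exprS.
Qed.

Lemma polyfun_monomial n k x : (k <= n)%N -> polyfun n.+1 (fun t => t ^+ k *:
  x).
Proof.
elim: k n => [|k IH] [|n]// kn.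
- by under eq_fun do rewrite expr0 scale1r; exact: polyfun_cst.
- by under eq_fun do rewrite expr0 scale1r; exact: polyfun_cst.
under eq_fun do rewrite exprS -scalerA.
exact/polyfunX/IH.
Qed.

(* F (2 t) - 2 ^ n F t has no term of degree n. *)
Lemma polyfun_eq0 n F (b : R) : polyfun n F ->
  (forall t : R, b <= t -> F t%:C = 0) -> forall t, F t = 0.
Proof.
(* With [1 <= b] the half-line from [b] is closed under doubling, and [b] is nonzero. *)
wlog b1 : b / 1 <= b => [W pF F0|].
  apply: (W (maxr 1 b) _ pF) => [|t]; first by rewrite le_max lexx.
  by rewrite ge_max => /andP[_]; exact: F0.
move=> [c Fc] F0.
suff c0 k : (k < n)%N -> c k = 0.
  by move=> t; rewrite Fc big1 // => k _; rewrite c0 ?scaler0.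
have {F Fc F0} : forall t : R, b <= t -> \sum_(k < n) t%:C ^+ k *: c k = 0.
  by move=> t bt; rewrite -Fc F0.
elim: n c k => // n IH c k c0 kn.
have ck j : (j < n)%N -> c j = 0.
  move=> jn; have := IH (fun i => (2 ^+ i - 2 ^+ n : R[i]) *: c i) j.
  have /[swap] /[apply] : forall t : R, b <= t ->
      \sum_(i < n) t%:C ^+ i *: ((2 ^+ i - 2 ^+ n : R[i]) *: c i) = 0.
    move=> t bt.
    have b2 : b <= 2 * t by lra.
    have : \sum_(k < n.+1) (2 * t)%:C ^+ k *: c k -
        2 ^+ n *: (\sum_(k < n.+1) t%:C ^+ k *: c k) = 0.
      by rewrite !c0// scaler0 subr0.
    rewrite scaler_sumr -sumrB big_ord_recr/=.
    rewrite rmorphM/= rmorph_nat exprMn scalerA subrr addr0 => e; rewrite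
      -[RHS]e.
    by apply: eq_bigr => i _; rewrite exprMn !scalerA -scalerBl; congr (_ *:
      _); ring.
  move=> /(_ jn)/eqP; rewrite scaler_eq0 subr_eq0 => /orP[|/eqP//].
  have two1 : (2 : R[i]) != 1 by rewrite gt_eqF// ltr1n.
  by rewrite (inj_eq (ieexprIn _ two1)) ?ltr0n// ltn_eqF.
have := c0 _ (lexx b); rewrite big_ord_recr/= big1 ?add0r => [|i _]; last first.
  by rewrite ck ?scaler0.
move=> /eqP; rewrite scaler_eq0 expf_eq0 => /orP[/andP[_]|/eqP cn].
  by rewrite gt_eqF// ltcR (lt_le_trans ltr01 b1).
by move: kn; rewrite ltnS leq_eqVlt => /orP[/eqP->|/ck].
Qed.

Context {E : lmodType R[i]} {m : nat} (phi : ('I_m -> E) -> X).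
Hypothesis phiP : multilinear phi.

Lemma multilinear_affine j (f : 'I_m -> E) (x z : E) (t : R[i]) :
  phi (fun i => if i == j then x + t *: z else f i) =
  phi (fun i => if i == j then x else f i) +
  t *: phi (fun i => if i == j then z else f i).
Proof. by rewrite addrC phiP addrC. Qed.

Lemma multilinear_homogeneous (x : E) (t : R[i]) :
  phi (fun=> t *: x) = t ^+ m *: phi (fun=> x).
Proof.
have phi0 j f : phi (fun i => if i == j then 0 else f i) = 0.
  have := multilinear_affine j f 0 0 1; rewrite !scale1r addr0 => /eqP.
  by rewrite -subr_eq0 opprD addNKr oppr_eq0 => /eqP.
suff H j : (j <= m)%N -> phi (fun i => if (i < j)%N then t *: x else x) =
    t ^+ j *: phi (fun=> x).
  by rewrite -H//; congr phi; apply/funext => i; rewrite ltn_ord.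
elim: j => [|j IH] jm; first by rewrite scale1r.
pose o := Ordinal jm; rewrite exprS -scalerA -IH ?(ltnW jm)//.
have := multilinear_affine o (fun i => if (i < j)%N then t *: x else x) 0 x t.
rewrite phi0 !add0r; congr (_ = _ *: _); congr phi; apply/funext => i;
  rewrite -[i == o]/(val i == j) /=.
- by rewrite ltnS; case: ltngtP.
- by case: eqVneq => // ->; rewrite ltnn.
Qed.

(** Induction on the number [j] of moving arguments: splitting the last of them by linearity gives
    [g x t + t *: g z t], one degree higher. *)
Lemma polyfun_multilinear (x z : E) (j : nat) (f : 'I_m -> E) : (j <= m)%N ->
  polyfun j.+1 (fun t => phi (fun i => if (i < j)%N then x + t *: z else f i)).
Proof.
elim: j f => [|j IH] f jm; first exact: (polyfun_cst 0 (phi f)).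
pose o := Ordinal jm.
pose g y t := phi (fun i => if (i < j)%N then x + t *: z else
                            if i == o then y else f i).
have E1 y h : phi (fun i => if i == o then y else if (i < j)%N then h i else f
  i)
   = phi (fun i => if (i < j)%N then h i else if i == o then y else f i).
  congr phi; apply/funext => i; case: eqVneq => [->/=|//].
  by rewrite ltnn.
rewrite [X in polyfun _ X](_ : _ = (fun t => g x t + t *: g z t)); last first.
  apply/funext => t; rewrite /g -(E1 x (fun=> _)) -(E1 z (fun=> _))
    -multilinear_affine; congr phi.
  apply/funext => i; rewrite ltnS leq_eqVlt -[(i == j :> nat)]/(i == o).
  by case: eqVneq.
apply: polyfunD; last by apply: polyfunX; apply: IH; exact: ltnW.
by apply: (@polyfun_widen j.+1) => //; apply: IH; exact: ltnW.
Qed.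

(** The derivative at [y], in the direction [z], of the polynomial that [phi] defines on the
    diagonal. *)
Definition differential (y z : E) : X :=
  \sum_j phi (fun i => if i == j then z else y).

Lemma differential_linear y : linear (differential y).
Proof.
move=> a u v; rewrite /differential scaler_sumr -big_split.
by apply: eq_bigr => j _; rewrite phiP.
Qed.

(** Euler's identity for homogeneous polynomials of degree [m]. *)
Lemma differential_diag y : differential y y = m%:R *: phi (fun=> y).
Proof.
rewrite /differential (eq_bigr (fun=> phi (fun=> y))).
  by rewrite sumr_const card_ord scaler_nat.
by move=> j _; congr phi; apply/funext => i; case: ifP.
Qed.

(** Telescoping: the arguments pass from [y] to [y + t *: z] one at a time, and [Q t] collects the
    increments with their factor [t] removed. *)
Lemma multilinear_taylor y z : exists Q, [/\ polyfun m.+1 Q,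
  Q 0 = differential y z &
  forall t, phi (fun=> y + t *: z) = phi (fun=> y) + t *: Q t].
Proof.
pose B (j : nat) t := phi (fun i => if (i < j)%N then y + t *: z else
                            if val i == j then z else y).
exists (fun t => \sum_(j < m) B j t); split.
- apply: polyfun_sum => j; apply: (@polyfun_widen j.+1); first by rewrite ltnS
  ltnW.
  exact/polyfun_multilinear/ltnW.
- apply: eq_bigr => j _; congr phi; apply/funext => i.
  rewrite scale0r addr0 -[val i == val j]/(i == j).
  by case: (eqVneq i j) => [->|_]; rewrite ?ltnn//; case: ifP.
move=> t.
suff H j : (j <= m)%N -> phi (fun i => if (i < j)%N then y + t *: z else y) =
    phi (fun=> y) + t *: \sum_(k < j) B k t.
  by rewrite -H//; congr phi; apply/funext => i; rewrite ltn_ord.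
elim: j => [|j IH] jm; first by rewrite big_ord0 scaler0 addr0.
rewrite big_ord_recr/= scalerDr addrA -IH ?(ltnW jm)//.
pose o := Ordinal jm.
have := multilinear_affine o (fun i => if (i < j)%N then y + t *: z else y) y z
  t.
congr (_ = _ + _ *: _); congr phi; apply/funext => i;
  rewrite -[i == o]/(val i == j) /=.
- by rewrite ltnS; case: ltngtP.
- by case: eqVneq => // ->; rewrite ltnn.
- by case: ltngtP.
Qed.

(** Additivity and homogeneity give [Q t = t ^+ m.-1 *: phi (fun=> z)] for real [t >= 1], hence for
    all [t], both sides being polynomial. At [t = 0] the right side vanishes because [m >= 2]. *)
Lemma differential_eq0 y z : (2 <= m)%N ->
  (forall t : R[i], phi (fun=> y + t *: z) = phi (fun=> y) + phi (fun=> t *: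
    z)) ->
  differential y z = 0.
Proof.
move=> m2 Hz; have [Q [pQ <- HQ]] := multilinear_taylor y z.
have pQz : polyfun m.+1 (fun t => Q t - t ^+ m.-1 *: phi (fun=> z)).
  by apply: polyfunB => //; apply: polyfun_monomial; exact: leq_pred.
have Qz0 (t : R) : 1 <= t -> Q t%:C - t%:C ^+ m.-1 *: phi (fun=> z) = 0.
  move=> t1; have t0 : t%:C != 0 by rewrite gt_eqF// ltcR (lt_le_trans ltr01).
  apply: (scalerI t0); rewrite scaler0 scalerBr scalerA -exprS prednK ?(ltnW
    m2)//.
  by rewrite -multilinear_homogeneous; apply: (addrI (phi (fun=> y)));
    rewrite addrA -HQ Hz addr0 addrK.
have := polyfun_eq0 pQz Qz0 0.
by rewrite expr0n -subn1 subn_eq0 leqNgt m2 scale0r subr0.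
Qed.

End PolynomialFunctions.

(** * Algebra of the adjoint *)

Section Adjoint.
Context {R : realType} {H : hilbertType R}.
Implicit Types (x y z : 'B(H)) (u v w : H).

Lemma mulopZl (a : R[i]) x y : (a *: x) * y = a *: (x * y).
Proof. exact: bopP. Qed.

Lemma mulopZr (a : R[i]) x y : x * (a *: y) = a *: (x * y).
Proof. by apply: bopP => u; exact: (linearZ_LR x). Qed.

Lemma inner_inj u v : (forall w, inner w u = inner w v) -> u = v.
Proof.
move=> uv; apply/eqP; rewrite -subr_eq0 -normr_eq0 -sqrf_eq0 -innerE.
by rewrite innerDr -scaleN1r innerZr rmorphN1 mulN1r uv subrr.
Qed.

Lemma adjoint_unique x y :
  (forall u v, inner (x u) v = inner u (y v)) -> adjoint x = y.
Proof. by move=> xy; apply: bopP => v; apply: inner_inj => u; rewrite -xy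
  adjointP. Qed.

Lemma adjointK x : adjoint (adjoint x) = x.
Proof.
by apply: adjoint_unique => u v; rewrite innerC -adjointP -innerC.
Qed.

Lemma adjointM x y : adjoint (x * y) = adjoint y * adjoint x.
Proof.
apply: adjoint_unique => u v.
by rewrite -[inner _ v]/(inner (x (y u)) v) 2!adjointP.
Qed.

Lemma adjointD x y : adjoint (x + y) = adjoint x + adjoint y.
Proof.
by apply: adjoint_unique => u v; rewrite (innerDl (x u)) (innerDr u) 2!adjointP.
Qed.

Lemma adjointZ (a : R[i]) x : adjoint (a *: x) = a^*%C *: adjoint x.
Proof.
apply: adjoint_unique => u v.
by rewrite (innerZl a (x u)) (innerZr _ u) conjcK adjointP.
Qed.

Lemma adjoint1 : adjoint (1 : 'B(H)) = 1.
Proof. exact: adjoint_unique. Qed.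

Lemma adjointN x : adjoint (- x) = - adjoint x.
Proof. by rewrite -scaleN1r adjointZ rmorphN1 scaleN1r. Qed.

Lemma adjointB x y : adjoint (x - y) = adjoint x - adjoint y.
Proof. by rewrite adjointD adjointN. Qed.

Lemma adjoint0 : adjoint (0 : 'B(H)) = 0.
Proof. by have := adjointZ 0 0; rewrite scale0r rmorph0 scale0r. Qed.

Lemma mutually_orthogonalC x y :
  mutually_orthogonal x y -> mutually_orthogonal y x.
Proof.
move=> [xy yx]; split.
  by rewrite -(adjointK y) -adjointM xy adjoint0.
by rewrite -(adjointK y) -adjointM yx adjoint0.
Qed.

End Adjoint.

(** * Additivity on transformed orthogonal pairs *)

Section Separation.
Context {R : realType} {H : hilbertType R} {X : lmodType R[i]} {m : nat}.
Context (phi : ('I_m -> 'B(H)) -> X) (phiP : multilinear phi).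
Let P (x : 'B(H)) := phi (fun=> x).
Implicit Types (x y s g h : 'B(H)).

Lemma polyfun_line x z : polyfun m.+1 (fun t => P (x + t *: z)).
Proof.
rewrite [X in polyfun _ X](_ : _ = fun t => phi (fun i => if (i < m)%N then x +
  t *: z else 0)).
  exact: polyfun_multilinear.
by apply/funext => t; congr phi; apply/funext => i; rewrite ltn_ord.
Qed.

(* A polynomial in l and its conjugate that vanishes identically also vanishes
   when the two are replaced by independent variables, here 1 and 0. *)
Lemma additive_independent x0 x1 y0 y1 :
  (forall l : R[i], P (x0 + l *: x1 + (y0 + l^*%C *: y1)) =
                    P (x0 + l *: x1) + P (y0 + l^*%C *: y1)) ->
  P (x0 + x1 + y0) = P (x0 + x1) + P y0.
Proof.
move=> Pl.
(* The defect of additivity, with the conjugate of [l] freed to an independent variable [k]. *)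
pose F (l k : R[i]) := P (x0 + l *: x1 + (y0 + k *: y1)) -
  (P (x0 + l *: x1) + P (y0 + k *: y1)).
have polyF (p q l k : R[i]) : polyfun m.+1 (fun t => F (p + t * l) (q + t * k)).
  have E a b (z w : 'B(H)) t : z + (a + t * b) *: w = z + a *: w + t *: (b *:
    w).
    by rewrite scalerDl -scalerA addrA.
  rewrite /F; under eq_fun do rewrite !E (addrACA _ (_ *: (l *: _))) -scalerDr.
  by apply: polyfunB; [|apply: polyfunD]; exact: polyfun_line.
have F0 (a b : R) : F (a%:C + 'i%C * b%:C) (a%:C - 'i%C * b%:C) = 0.
  rewrite /F; have := Pl (a%:C + 'i%C * b%:C).
  have -> : (a%:C + 'i%C * b%:C)^*%C = a%:C - 'i%C * b%:C.
    by apply/eqP; rewrite eq_complex /=; apply/andP; split; apply/eqP; ring.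
  by move=> ->; rewrite subrr.
(* For fixed [b] this is polynomial in [a], so real [a] may become complex; next, the same is done
   for [b]. *)
have {}F0 (a : R[i]) (b : R) : F (a + 'i%C * b%:C) (a - 'i%C * b%:C) = 0.
  have pF := polyF ('i%C * b%:C) (- ('i%C * b%:C)) 1 1.
  have F0b (t : R) : 0 <= t -> F ('i%C * b%:C + t%:C * 1) (- ('i%C * b%:C) +
    t%:C * 1) = 0.
    by rewrite mulr1 addrC (addrC (- _)).
  by have := polyfun_eq0 pF F0b a; rewrite mulr1 addrC (addrC (- _)).
have {}F0 (a b : R[i]) : F (a + b * 'i%C) (a - b * 'i%C) = 0.
  have pF := polyF a a 'i%C (- 'i%C).
  have F0a (t : R) : 0 <= t -> F (a + t%:C * 'i%C) (a + t%:C * - 'i%C) = 0.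
    by rewrite mulrN (mulrC _ 'i%C).
  by have := polyfun_eq0 pF F0a b; rewrite mulrN.
(* These values solve [a + b * 'i = 1] and [a - b * 'i = 0]. *)
have := F0 (2^-1) (- ('i%C * 2^-1)).
have -> : - ('i%C * 2^-1) * 'i%C = 2^-1 :> R[i].
  by rewrite mulNr mulrAC -expr2 sqr_i mulN1r opprK.
have -> : 2^-1 + 2^-1 = 1 :> R[i] by field.
rewrite subrr /F scale1r scale0r addr0 => /eqP.
by rewrite subr_eq0 => /eqP.
Qed.

Definition separated g h g' h' := forall x y, mutually_orthogonal x y ->
  P (g * x * h + g' * y * h') = P (g * x * h) + P (g' * y * h').

Lemma separatedC g h g' h' : separated g h g' h' -> separated g' h' g h.
Proof.
by move=> sep x y /mutually_orthogonalC/sep; rewrite addrC [in RHS]addrC.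
Qed.

(** With [r = l *: s] one has [(1 - r) * (1 + r) = 1], so [(1 + r) * x] and [(1 - adjoint r) * y]
    are again orthogonal. Decoupling [l] from its conjugate keeps the factor of [x] and discards
    that of [y]. *)
Lemma separated_mull s g h g' h' : s * s = 0 ->
  separated g h g' h' -> separated (g * (1 + s)) h g' h'.
Proof.
move=> ss sep x y [xy yx].
have := @additive_independent (g * x * h) (g * (s * x) * h)
  (g' * y * h') (- (g' * (adjoint s * y) * h')).
rewrite -[g * (1 + s) * x]mulrA [(1 + s) * x]mulrDl mul1r [g * (x + _)]mulrDr
  [(_ + _) * h]mulrDl.
apply=> l; pose r := l *: s.
have rr : r * r = 0 by rewrite mulopZl mulopZr ss !scaler0.
have -> : g * x * h + l *: (g * (s * x) * h) = g * ((1 + r) * x) * h.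
  by rewrite mulrDl mul1r mulrDr mulrDl !(mulopZl, mulopZr).
have -> : g' * y * h' + l^*%C *: (- (g' * (adjoint s * y) * h')) =
    g' * ((1 - adjoint r) * y) * h'.
  by rewrite mulrBl mul1r mulrBr mulrBl adjointZ !(mulopZl, mulopZr) scalerN.
apply: sep.
split; rewrite adjointM adjointB adjointK adjoint1.
  by rewrite -mulrA (mulrA x) xy mul0r mulr0.
rewrite mulrA -(mulrA (adjoint y)).
have -> : (1 - r) * (1 + r) = 1.
  by rewrite mulrDl mul1r mulNr mulrDr rr mulr1 addr0 addrK.
by rewrite mulr1.
Qed.

Lemma separated_mulr s g h g' h' : s * s = 0 ->
  separated g h g' h' -> separated g ((1 + s) * h) g' h'.
Proof.
move=> ss sep x y [xy yx].
have := @additive_independent (g * x * h) (g * (x * s) * h)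
  (g' * y * h') (- (g' * (y * adjoint s) * h')).
rewrite [g * x * (_ * h)]mulrA -[g * x * (1 + s)]mulrA [x * (1 + s)]mulrDr
  mulr1 [g * (x + _)]mulrDr [(_ + _) * h]mulrDl.
apply=> l; pose r := l *: s.
have rr : r * r = 0 by rewrite mulopZl mulopZr ss !scaler0.
have -> : g * x * h + l *: (g * (x * s) * h) = g * (x * (1 + r)) * h.
  by rewrite mulrDr mulr1 mulrDr mulrDl !(mulopZr, mulopZl).
have -> : g' * y * h' + l^*%C *: (- (g' * (y * adjoint s) * h')) =
    g' * (y * (1 - adjoint r)) * h'.
  by rewrite mulrBr mulr1 mulrBr mulrBl adjointZ !(mulopZr, mulopZl) scalerN.
apply: sep.
split; rewrite adjointM adjointB adjointK adjoint1; last first.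
  by rewrite -mulrA (mulrA (adjoint y)) yx mul0r mulr0.
rewrite mulrA -(mulrA x).
have -> : (1 + r) * (1 - r) = 1.
  by rewrite mulrDl mul1r mulrDr mulr1 mulrN rr subr0 subrK.
by rewrite mulr1.
Qed.

End Separation.

(** * Vanishing on corners and Schur complements *)

Section Corners.
Context {R : realType} {H : hilbertType R} {X : lmodType R[i]} {m : nat}.
Context (phi : ('I_m -> 'B(H)) -> X) (phiP : multilinear phi) (m2 : (2 <= m)%N).
Let P (x : 'B(H)) := phi (fun=> x).
Implicit Types (x y s g h e f b c : 'B(H)).

Definition projection e := e * e = e /\ adjoint e = e.

(* x = e x f says that x is an operator from the range of f to that of e. *)
Definition in_corner e f x := e * x = x /\ x * f = x.

Lemma in_corner_sqr0 e f x : f * e = 0 -> in_corner e f x -> x * x = 0.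
Proof.
by move=> fe [ex xf]; rewrite -{1}xf -{2}ex mulrA -(mulrA x) fe mulr0 mul0r.
Qed.

Lemma in_corner_orthogonal e f x y : projection e -> projection f -> e * f = 0
  ->
  in_corner e e x -> in_corner f f y -> mutually_orthogonal x y.
Proof.
move=> [_ ea] [_ fa] ef [ex xe] [fy yf]; split.
  by rewrite -xe -yf adjointM fa mulrA -(mulrA x) ef mulr0 mul0r.
by rewrite -ex -fy adjointM fa mulrA -(mulrA _ f) -{1}fa -{1}ea -adjointM ef
  adjoint0 mulr0 mul0r.
Qed.

(* A single product would do but for the rank-one defect of exists_halving. *)
Definition factors_through f e := exists c1 b1 c2 b2,
  [/\ in_corner f e c1 /\ in_corner e f b1, in_corner f e c2 /\ in_corner e f
    b2 &
      f = c1 * b1 + c2 * b2].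

(* The differential at g d h kills every g c b h with c : e -> f and b : f -> e;
   g d h is a sum of these when the identity of f factors through e. *)
Lemma corner_eq0 e f g h d :
  projection e -> projection f -> e * f = 0 -> f * e = 0 -> factors_through f e
    ->
  separated phi g h g h -> in_corner f f d -> P (g * d * h) = 0.
Proof.
move=> pe pf ef fe [c1 [b1 [c2 [b2 [[c1P b1P] [c2P b2P] fE]]]]] sep dP.
set Y := g * d * h.
pose L := differential phi Y.
have LD x y : L (x + y) = L x + L y.
  by have := differential_linear phiP Y 1 x y; rewrite !scale1r.
have L0 c b : in_corner f e c -> in_corner e f b ->
    L (g * ((1 + c) * e * (1 + b)) * h) = 0.
  move=> cP bP; apply: differential_eq0 => // t.
  have /(separated_mulr phiP (in_corner_sqr0 fe bP)) :=
    separated_mull phiP (in_corner_sqr0 ef cP) sep.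
  move=> /(_ (t *: e) d).
  have -> : g * (1 + c) * (t *: e) * ((1 + b) * h) =
      t *: (g * ((1 + c) * e * (1 + b)) * h).
    by rewrite !(mulopZl, mulopZr) !mulrA.
  rewrite addrC => ->; first by rewrite addrC.
  apply: (in_corner_orthogonal pe pf ef _ dP).
  by split; rewrite !(mulopZl, mulopZr) pe.1.
have corner0 x y : in_corner x y 0 by split; rewrite ?mulr0 ?mul0r.
(* [(1 + c) * e * (1 + b)] is [e + c + b + c * b]; the cases where [c], [b] or both are zero dispose
   of the first three terms. *)
have Lcb c b : in_corner f e c -> in_corner e f b -> L (g * (c * b) * h) = 0.
  move=> cP bP.
  have E c' b' : in_corner f e c' -> in_corner e f b' ->
    (1 + c') * e * (1 + b') = e + c' + b' + c' * b'.
    move=> [_ ce] [eb _]; rewrite mulrDl mul1r ce mulrDl !mulrDr !mulr1 eb.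
    by rewrite !addrA [e + b' + c']addrAC.
  have := L0 _ _ (corner0 _ _) (corner0 _ _); have := L0 _ _ cP (corner0 _ _).
  have := L0 _ _ (corner0 _ _) bP; have := L0 _ _ cP bP.
  rewrite !E// !mulr0 !mul0r !addr0 !mulrDr !mulrDl !LD => Ecb Eb Ec Ee.
  by move: Eb Ec Ecb; rewrite Ee !add0r => -> ->; rewrite !add0r.
(* [b * d] is again an operator from the range of [f] to that of [e], and the factorization of [f]
   splits [d = f * d]. *)
have LY : L Y = 0.
  have bd b : in_corner e f b -> in_corner e f (b * d).
    by move=> [eb _]; split; rewrite -?mulrA ?dP.2// mulrA eb.
  have -> : Y = g * (c1 * (b1 * d)) * h + g * (c2 * (b2 * d)) * h.
    by rewrite -mulrDl -mulrDr !mulrA -mulrDl -fE dP.1.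
  by rewrite LD !Lcb ?addr0//; exact: bd.
move: LY; rewrite /L differential_diag => /eqP.
by rewrite scaler_eq0 pnatr_eq0 gtn_eqF ?(ltnW m2)//= => /eqP.
Qed.

Hypothesis Padd : orthogonally_additive P.

Lemma separated1 : separated phi 1 1 1 1.
Proof. by move=> x y xy; rewrite !mul1r !mulr1; exact: Padd. Qed.

(** The factors are attached to one member of the pair, then, after an exchange, to the other. *)
Lemma separated_refl c b : c * c = 0 -> b * b = 0 ->
  separated phi (1 + c) (1 + b) (1 + c) (1 + b).
Proof.
move=> cc bb; have := separated1.
move=> /(separated_mull phiP cc)/(separated_mulr phiP bb)/separatedC.
move=> /(separated_mull phiP cc)/(separated_mulr phiP bb).
by rewrite !mul1r !mulr1.
Qed.

(** As [a] commutes with [p], [v * p] inverts [a * p] in the corner of [p], and block elimination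
    writes [M] as [(1 + c) * (a * p) * (1 + b) + d]. [P] is additive on these two summands, and
    [corner_eq0] kills each, with [p] and [1 - p] trading roles. *)
Lemma block_eq0 p (M : 'B(H)) a v : projection p ->
  factors_through p (1 - p) -> factors_through (1 - p) p ->
  a * v = 1 -> v * a = 1 -> a * p = p * a -> p * M * p = a * p -> P M = 0.
Proof.
have [q qE] : exists q, q = 1 - p by exists (1 - p).
move=> pp; rewrite -qE => pq qp av va ap Ma.
have [ppE pa] := pp; have e1 : p + q = 1 by rewrite qE addrC subrK.
have pqE : p * q = 0 by rewrite qE mulrBr mulr1 ppE subrr.
have qpE : q * p = 0 by rewrite qE mulrBl mul1r ppE subrr.
have qqE : q * q = q by rewrite {1}qE mulrBl mul1r pqE subr0.
have qq : projection q by split=> //; rewrite qE adjointB adjoint1 pa.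
have vp : v * p = p * v.
  by rewrite -[v * p]mulr1 -av mulrA -(mulrA v) -ap mulrA va mul1r.
have [c cE] : exists c, c = q * M * p * v by exists (q * M * p * v).
have [b bE] : exists b, b = v * p * M * q by exists (v * p * M * q).
have cP : in_corner q p c.
  by split; rewrite cE ?mulrA ?qqE// -(mulrA _ v) vp mulrA -(mulrA _ p p) ppE.
have bP : in_corner p q b.
  by split; rewrite bE -?mulrA ?qqE// mulrA -vp !mulrA -(mulrA v) ppE.
(* The Schur complement of the corner of [M] at [p]. *)
pose d := q * M * q - c * (a * p) * b.
have dP : in_corner q q d.
  rewrite /d; split.
    by rewrite mulrBr !mulrA qqE cP.1.
  by rewrite mulrBl -!mulrA qqE bP.2.
have aP : in_corner p p (a * p).
  by split; [rewrite mulrA -ap -mulrA ppE|rewrite -mulrA ppE].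
have cc := in_corner_sqr0 pqE cP; have bb := in_corner_sqr0 qpE bP.
have ME : M = (1 + c) * (a * p) * (1 + b) + 1 * d * 1.
  have ca : c * (a * p) = q * M * p.
    by rewrite cE mulrA -(mulrA _ v) va mulr1 -(mulrA _ p p) ppE.
  have ab : a * p * b = p * M * q.
    by rewrite bE !mulrA -(mulrA a p v) -vp mulrA av mul1r ppE.
  rewrite mul1r mulr1 /d (mulrDl 1) mul1r (mulrDr _ 1) mulr1 (mulrDl (a * p))
    ab.
  set k := _ * b; rewrite ca -Ma -[LHS]mul1r -[LHS]mulr1 -[in LHS]e1 !mulrDl
    !mulrDr.
  by rewrite addrACA -!addrA [k + _]addrC subrK.
have sep : separated phi (1 + c) (1 + b) 1 1.
  have := separated1; move=> /(separated_mull phiP cc)/(separated_mulr phiP bb).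
  by rewrite mul1r mulr1.
have := sep _ _ (in_corner_orthogonal pp qq pqE aP dP); rewrite -ME /P => ->.
have := corner_eq0 qq pp qpE pqE pq (separated_refl cc bb) aP.
have := corner_eq0 pp qq pqE qpE qp separated1 dP.
by rewrite /P => -> ->; rewrite addr0.
Qed.

(** The corner of [M + t] at [p] is [a * p] with [a = p * M * p + t], which commutes with [p] and is
    invertible for large real [t]. The polynomial [P (M + t)] in [t] vanishes for these [t], hence
    at [0]. *)
Lemma halving_eq0 p (M : 'B(H)) : projection p ->
  factors_through p (1 - p) -> factors_through (1 - p) p ->
  (forall x, exists r : R, forall t : R, r <= t ->
    exists v : 'B(H), (x + t%:C *: (1 : 'B(H))) * v = 1 /\
                      v * (x + t%:C *: (1 : 'B(H))) = 1) ->
  P M = 0.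
Proof.
move=> pp pq qp inv; have [r rP] := inv (p * M * p).
have /polyfun_eq0 H0 := polyfun_line phiP M 1.
have := H0 r _ 0; rewrite scale0r addr0; apply=> t /rP[v [tv vt]].
have ppE := pp.1.
apply: (block_eq0 pp pq qp tv vt).
  rewrite mulrDl mulrDr mulopZl mulopZr mul1r mulr1 !mulrA ppE.
  by rewrite -(mulrA _ p p) ppE.
by rewrite mulrDr !mulrDl mulopZr !mulopZl mulr1 mul1r ppE -(mulrA _ p p) ppE.
Qed.

End Corners.

(** * Real-valued norm, limits and inverses of operators *)

Section RealNorm.
Context {R : realType} {H : hilbertType R}.
Implicit Types (u v w : H) (x : 'B(H)).

(** Norms in [H] take values in the partially ordered [R[i]]; suprema and order arguments are
    carried out in [R]. *)
Definition rnorm u : R := complex.Re `|u|.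

Lemma rnormE u : (rnorm u)%:C = `|u|. Proof. exact: ReK_norm. Qed.

Lemma rnorm_ge0 u : 0 <= rnorm u. Proof. by rewrite -ler0c rnormE. Qed.

Lemma rnormD u v : rnorm (u + v) <= rnorm u + rnorm v.
Proof. by rewrite -lecR rmorphD/= !rnormE ler_normD. Qed.

Lemma rnormN u : rnorm (- u) = rnorm u. Proof. by rewrite /rnorm normrN. Qed.

Lemma rnorm_le0 u : rnorm u <= 0 -> u = 0.
Proof. by rewrite -lecR rnormE normr_le0 => /eqP. Qed.

Lemma rnorm_gt0 u : u != 0 -> 0 < rnorm u.
Proof. by rewrite -normr_gt0 -rnormE ltcR. Qed.

Lemma rnormZ (a : R[i]) u : rnorm (a *: u) = complex.Re `|a| * rnorm u.
Proof.
have aE : `|a| = (complex.Re `|a|)%:C by rewrite RRe_real ?normr_real.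
by rewrite /rnorm normrZ {1}aE -[`|u|]rnormE -rmorphM.
Qed.

Lemma rnorm_sqr u : inner u u = (rnorm u ^+ 2)%:C.
Proof. by rewrite innerE -rnormE rmorphXn. Qed.

Lemma bop_rbounded x : exists2 k : R, 0 < k & forall u, rnorm (x u) <= k *
  rnorm u.
Proof.
have [k xk] := bop_bounded x; exists (`|k| + 1) => [|u].
  by rewrite ltr_wpDl.
have := xk u; rewrite -!rnormE -rmorphM lecR => /le_trans; apply.
by rewrite ler_wpM2r ?rnorm_ge0// (le_trans (ler_norm k))// lerDl.
Qed.

Lemma bounded_linear_rnorm (f : H -> H) (k : R) : linear f ->
  (forall u, rnorm (f u) <= k * rnorm u) -> f \in bounded_linear.
Proof.
move=> fl fk; apply/bounded_linearP; split => //; exists k => u.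
by rewrite -!rnormE -rmorphM lecR.
Qed.

Section Limits.
Context {I : Type} (F : set_system I) {FF : ProperFilter F}.

Lemma cvg_rnormP (f : I -> H) (l : H) : f @ F --> l <->
  forall e : R, 0 < e -> F [set i | rnorm (l - f i) < e].
Proof.
split=> [/cvgrPdist_lt fl e e0|fl].
  have : 0 < e%:C by rewrite ltcR.
  by move=> /fl; apply: filterS => i; rewrite -rnormE ltcR.
apply/cvgrPdist_lt => e e0.
have eE : (complex.Re e)%:C = e by rewrite RRe_real// gtr0_real.
have : 0 < complex.Re e by rewrite -ltcR eE.
by move=> /fl; apply: filterS => i /= li; rewrite -eE -rnormE ltcR.
Qed.

Lemma rnorm_complete (f : I -> H) :
  (forall e : R, 0 < e -> exists u, F [set i | rnorm (u - f i) < e]) ->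
  exists l : H, f @ F --> l.
Proof.
move=> fc; apply/cvg_ex; apply: cauchy_cvg; apply: cauchy_exP => e e0.
have eE : (complex.Re e)%:C = e by rewrite RRe_real// gtr0_real.
have : 0 < complex.Re e by rewrite -ltcR eE.
move=> /fc[u Fu]; exists u; apply: (@filterS _ F _ _ _ _ Fu) => i /= ui.
by rewrite -ball_normE /= -eE -rnormE ltcR.
Qed.

Lemma bop_cvg x (f : I -> H) (l : H) : f @ F --> l -> (fun i => x (f i)) @ F
  --> x l.
Proof.
move=> /cvg_rnormP fl; apply/cvg_rnormP => e e0.
have [k k0 xk] := bop_rbounded x.
have : 0 < e / k by rewrite divr_gt0.
move=> /fl; apply: filterS => i /=; rewrite ltr_pdivlMr// mulrC =>
  /(le_lt_trans _); apply.
by rewrite -linearB; exact: xk.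
Qed.

Lemma hilbert_cvg_unique (f : I -> H) (l l' : H) :
  f @ F --> l -> f @ F --> l' -> l = l'.
Proof. exact/cvg_unique/norm_hausdorff. Qed.

End Limits.

(** The inverse sends [u] to the fixed point of [w = u + a w]; the iterates from [0] are the partial
    sums of the Neumann series. Uniqueness of the fixed point gives linearity and the left
    inverse. *)
Lemma neumann (a : 'B(H)) : (forall u, rnorm (a u) <= 2^-1 * rnorm u) ->
  exists v : 'B(H), (1 - a) * v = 1 /\ v * (1 - a) = 1.
Proof.
move=> ha.
have uniq u w w' : w = u + a w -> w' = u + a w' -> w = w'.
  move=> wE wE'; apply/eqP; rewrite -subr_eq0; apply/eqP/rnorm_le0.
  have : w - w' = a (w - w') by rewrite linearB {1}wE {1}wE' opprD addrACA
    subrr add0r.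
  by move=> e; have := ha (w - w'); rewrite -e; lra.
have /choice[v vE] u : exists w, w = u + a w.
  pose y k := iter k (fun w => u + a w) 0.
  have y2 k : rnorm (y k) <= 2 * rnorm u.
    elim: k => [|k IH]; first by rewrite /= /rnorm normr0 mulr_ge0// rnorm_ge0.
    by have := rnormD u (a (y k)); have := ha (y k); rewrite /= -/(y k); lra.
  have yd k n : rnorm (y k - y (k + n)%N) <= 2^-1 ^+ k * (2 * rnorm u).
    elim: k => [|k IH]; first by rewrite sub0r rnormN mul1r.
    rewrite /= -/(y k) -/(y (k + n)%N) opprD addrACA subrr add0r -linearB exprS
      -mulrA.
    by rewrite (le_trans (ha _))// ler_wpM2l.
  have [l yl] : exists l : H, y @ \oo --> l.
    apply: rnorm_complete => e e0.
    (* Since [k < 2 ^ k], this choice makes [2 * rnorm u / 2 ^ k] smaller than [e]. *)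
    pose k := Num.bound (2 * rnorm u / e); exists (y k); exists k => // i ki.
    have iE := subnKC (ki : (k <= i)%N); rewrite -iE.
    apply: (le_lt_trans (yd _ _)); rewrite exprVn mulrC.
    rewrite ltr_pdivrMr ?exprn_gt0// [ltRHS]mulrC -ltr_pdivrMr//.
    have := archi_boundP (x := 2 * rnorm u / e); rewrite -/k.
    rewrite divr_ge0 ?mulr_ge0 ?rnorm_ge0 ?ltW// => /(_ isT)/lt_le_trans; apply.
    by rewrite -natrX ler_nat ltnW// ltn_expl.
  exists l; apply: (@hilbert_cvg_unique _ \oo _ (fun k => y k.+1)).
    by rewrite cvg_shiftS.
  by apply: cvgD; [exact: cvg_cst|exact: bop_cvg].
have vl : linear v.
  move=> c u w; apply: (uniq (c *: u + w)); first exact: vE.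
  rewrite {1}(vE u) {1}(vE w) linearP scalerDr.
  by rewrite addrACA.
have vb u : rnorm (v u) <= 2 * rnorm u.
  by have := rnormD u (a (v u)); have := ha (v u); rewrite -vE; lra.
exists (BoundedOperator (bounded_linear_rnorm vl vb)).
split; apply: bopP => u.
  by rewrite -[LHS]/(v u - a (v u)) {1}(vE u) addrK.
by apply: (uniq (u - a u)); [exact: vE|rewrite subrK].
Qed.

(** [x + t = t (1 - a)] with [a = - x / t], which halves norms as soon as [t] is at least twice a
    bound of [x]. *)
Lemma shift_invertible x : exists r : R, forall t : R, r <= t ->
  exists v : 'B(H), (x + t%:C *: (1 : 'B(H))) * v = 1 /\
                    v * (x + t%:C *: (1 : 'B(H))) = 1.
Proof.
have [k k0 xk] := bop_rbounded x; exists (2 * k) => t kt.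
have t0 : 0 < t by lra.
have tC : t%:C != 0 by rewrite gt_eqF// ltcR.
pose a : 'B(H) := - (t^-1)%:C *: x.
have [u|v [av va]] := @neumann a.
  rewrite -[a u]/(- (t^-1)%:C *: x u) rnormZ normrN ger0_norm ?ler0c ?invr_ge0
    ?(ltW t0)//=.
  rewrite mulrC ler_pdivrMr// (le_trans (xk u))//.
  by have := rnorm_ge0 u; nra.
have aE : x + t%:C *: (1 : 'B(H)) = t%:C *: (1 - a).
  by rewrite /a scaleNr opprK scalerDr scalerA -rmorphM/= divff ?gt_eqF//
    scale1r addrC.
exists (t%:C^-1 *: v); rewrite aE !(mulopZl, mulopZr) !scalerA av va.
by rewrite divff// mulVf// scale1r.
Qed.

End RealNorm.

(** * Rank-one operators *)

Section RankOne.
Context {R : realType} {H : hilbertType R}.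
Implicit Types (u v w z : H) (x y : 'B(H)).

Lemma inner0l (v : H) : inner 0 v = 0.
Proof. by have := innerZl 0 0 v; rewrite scale0r mul0r. Qed.

Lemma inner0r (v : H) : inner v 0 = 0.
Proof. by rewrite innerC inner0l conjc0. Qed.

Lemma rnorm_pythagoras u v : inner u v = 0 ->
  rnorm (u + v) ^+ 2 = rnorm u ^+ 2 + rnorm v ^+ 2.
Proof.
move=> uv; have vu : inner v u = 0 by rewrite innerC uv conjc0.
apply: (fmorph_inj (real_complex R)); rewrite rmorphD /= -!rnorm_sqr.
by rewrite innerDl !innerDr uv vu addr0 add0r.
Qed.

Lemma unit_vector u : u != 0 -> inner ((rnorm u)^-1%:C *: u) ((rnorm u)^-1%:C
  *: u) = 1.
Proof.
move=> u0; rewrite innerZl innerZr rnorm_sqr conjc_real -!rmorphM/=.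
have := rnorm_gt0 u0; move: (rnorm u) => r r0.
by rewrite (_ : _ * _ = 1)//; field; rewrite gt_eqF.
Qed.

Lemma rank_one_subproof v u : (fun w => inner w u *: v) \in bounded_linear.
Proof.
apply: (@bounded_linear_rnorm _ _ _ (rnorm u * rnorm v)) => [a w w'|w].
  by rewrite innerDl innerZl scalerDl scalerA.
rewrite rnormZ mulrAC ler_wpM2r ?rnorm_ge0//.
have [->|u0] := eqVneq u 0.
  by rewrite inner0r normr0 mulr_ge0 ?rnorm_ge0.
have [e ee uE] : exists2 e, inner e e = 1 & u = (rnorm u)%:C *: e.
  exists ((rnorm u)^-1%:C *: u); first exact: unit_vector.
  by rewrite scalerA -rmorphM/= divff ?scale1r// gt_eqF// rnorm_gt0.
rewrite {1}uE innerZr conjc_real normrM ger0_norm ?ler0c ?rnorm_ge0//.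
have -> : complex.Re ((rnorm u)%:C * `|inner w e|) =
    rnorm u * complex.Re `|inner w e| by case: `|_| => a b /=; rewrite mul0r
      subr0.
rewrite ler_wpM2l ?rnorm_ge0//.
(* Cauchy-Schwarz against the unit vector [e]: [p] is the projection of [w] onto the line of [e],
   and Pythagoras bounds its norm by that of [w]. *)
pose p := inner w e *: e.
have pw : inner (w - p) p = 0.
  by rewrite innerDl -scaleN1r innerZr !innerZl innerZr ee mulr1 mulN1r mulrC
    subrr.
have -> : complex.Re `|inner w e| = rnorm p.
  rewrite /p rnormZ; suff -> : rnorm e = 1 by rewrite mulr1.
  apply/eqP; rewrite -(eqrXn2 (n := 2)) ?rnorm_ge0// expr1n.
  by have := rnorm_sqr e; rewrite ee => /(congr1 (@complex.Re R)) /= <-.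
rewrite -ler_sqr ?nnegrE ?rnorm_ge0// -[in leRHS](subrK p w) rnorm_pythagoras//.
by rewrite lerDr sqr_ge0.
Qed.

Definition rank_one v u : 'B(H) := BoundedOperator (rank_one_subproof v u).

Lemma mul_rank_one x v u : x * rank_one v u = rank_one (x v) u.
Proof. by apply: bopP => w; exact: (linearZ_LR x). Qed.

Lemma rank_one_mul x v u : rank_one v u * x = rank_one v (adjoint x u).
Proof. by apply: bopP => w; rewrite -[LHS]/(inner (x w) u *: v) adjointP. Qed.

Lemma rank_one0l u : rank_one 0 u = 0.
Proof. by apply: bopP => w; exact: scaler0. Qed.

Lemma rank_one0r v : rank_one v 0 = 0.
Proof.
by apply: bopP => w; rewrite -[LHS]/(inner w 0 *: v) inner0r scale0r.
Qed.

Lemma rank_oneE v u w : rank_one v u w = inner w u *: v.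
Proof. by []. Qed.

Lemma adjoint_rank_one v u : adjoint (rank_one v u) = rank_one u v.
Proof.
apply: adjoint_unique => w z; rewrite !rank_oneE innerZl innerZr.
by rewrite -innerC mulrC.
Qed.

End RankOne.

(** * Partial isometries of square zero and their maximal elements *)

Section PartialIsometries.
Context {R : realType} {H : hilbertType R}.
Implicit Types (n m k x y z : 'B(H)).

(** The second equation defines partial isometries; the first makes the initial projection
    [adjoint n * n] and the final projection [n * adjoint n] orthogonal. *)
Definition nilpotent_isometry n := n * n = 0 /\ n * adjoint n * n = n.

(** For a partial isometry [n]: [m - n] vanishes on the initial space of [n] and has range
    orthogonal to its final space. *)
Definition extends n m := m * (adjoint n * n) = n /\ n * adjoint n * m = n.

Lemma nilpotent_isometry_adjoint n :
  nilpotent_isometry n -> nilpotent_isometry (adjoint n).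
Proof.
move=> [nn nnn]; split; first by rewrite -adjointM nn adjoint0.
by have /(congr1 adjoint) := nnn; rewrite !adjointM adjointK mulrA.
Qed.

Lemma extends_adjoint n m : extends n m -> extends (adjoint n) (adjoint m).
Proof.
move=> [mn nm]; split; rewrite adjointK.
  by have /(congr1 adjoint) := nm; rewrite !adjointM adjointK.
by have /(congr1 adjoint) := mn; rewrite !adjointM adjointK.
Qed.

Lemma extends_mul n m : nilpotent_isometry n -> extends n m ->
  adjoint m * n = adjoint n * n.
Proof.
move=> [_ nnn] [_ nm].
have -> : adjoint n * n = adjoint (n * adjoint n * m) * n by rewrite nm.
by rewrite !adjointM adjointK -!mulrA (mulrA n) nnn.
Qed.

Lemma extends_refl n : nilpotent_isometry n -> extends n n.
Proof. by move=> [_ nnn]; split=> //; rewrite mulrA. Qed.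

Lemma extends_trans n m k : nilpotent_isometry n -> nilpotent_isometry m ->
  extends n m -> extends m k -> extends n k.
Proof.
(* The first equation of [extends] suffices: the second is the first for the adjoints. *)
have half n' m' k' : nilpotent_isometry n' -> extends n' m' -> extends m' k' ->
    k' * (adjoint n' * n') = n'.
  move=> nP nm mk; have [mn _] := nm; have [km _] := mk.
  by rewrite -(extends_mul nP nm) -{1}mn (mulrA (adjoint m')) (mulrA k') km.
move=> nP mP nm mk; split; first exact: half nm mk.
have := half _ _ _ (nilpotent_isometry_adjoint nP) (extends_adjoint nm)
  (extends_adjoint mk).
by move=> /(congr1 adjoint); rewrite !adjointM !adjointK.
Qed.

Lemma nilpotent_isometry_le n u : nilpotent_isometry n -> rnorm (n u) <= rnorm
  u.
Proof.
move=> [_ nnn]; have [p pE] : exists p, p = adjoint n * n by exists (adjoint n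
  * n).
have pp v : p (p v) = p v.
  by rewrite -[LHS]/((p * p) v) {1}pE -mulrA pE (mulrA n) nnn.
have pa : adjoint p = p by rewrite pE adjointM adjointK.
have npE : rnorm (n u) ^+ 2 = rnorm (p u) ^+ 2.
  apply: (fmorph_inj (real_complex R)); rewrite /= -!rnorm_sqr !adjointP pa pp.
  by rewrite pE.
have up : inner (u - p u) (p u) = 0.
  rewrite -[in X in inner _ X]pa -adjointP linearB /= pp subrr.
  exact: inner0l.
rewrite -ler_sqr ?nnegrE ?rnorm_ge0// npE -[in leRHS](subrK (p u) u).
by rewrite rnorm_pythagoras// lerDr sqr_ge0.
Qed.

(** [m u - n u] is orthogonal to [n u]. Hence convergence of the norms along a chain makes the
    vectors Cauchy. *)
Lemma extends_dist n m u : nilpotent_isometry n -> extends n m ->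
  rnorm (n u - m u) ^+ 2 = rnorm (m u) ^+ 2 - rnorm (n u) ^+ 2.
Proof.
move=> nP nm.
have E : inner (m u) (n u) = inner (n u) (n u).
  by rewrite !adjointP -[adjoint m _]/((adjoint m * n) u) (extends_mul nP nm).
have := @rnorm_pythagoras _ _ (m u - n u) (n u).
rewrite subrK => ->; first by rewrite addrK -rnormN opprB.
by rewrite innerDl -scaleN1r innerZl mulN1r E subrr.
Qed.

Section Chain.
Variable A : set 'B(H).
Hypotheses (A0 : A !=set0) (AP : forall n, A n -> nilpotent_isometry n)
  (Atot : total_on A extends).

(** The tails of the chain [A]; pointwise limits along them are strong operator limits. *)
Definition chain_filter : set_system 'B(H) :=
  filter_from A (fun n => [set m | A m /\ extends n m]).

Lemma chain_filter_proper : ProperFilter chain_filter.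
Proof.
apply: filter_from_proper => [|n An]; last first.
  by exists n; split=> //; exact/extends_refl/AP.
apply: filter_from_filter => // n m An Am.
have [nm|mn] := Atot An Am; [exists m|exists n] => // k [Ak mk]; split; split=>
  //.
- by apply: extends_trans nm mk; exact: AP.
- by apply: extends_trans mn mk; exact: AP.
Qed.

(** The squared norms [rnorm (n u) ^+ 2] grow along the chain and are bounded by that of [u], so
    beyond an [n] close to their supremum [extends_dist] bounds the distance. *)
Lemma chain_cvg u : exists l : H, (fun m : 'B(H) => m u) @ chain_filter --> l.
Proof.
have FF := chain_filter_proper; apply: rnorm_complete => e e0.
pose S := [set rnorm (n u) ^+ 2 | n in A].
have Ssup : has_sup S.
  split; first by case: A0 => n An; exists (rnorm (n u) ^+ 2), n.
  exists (rnorm u ^+ 2) => _ [n An <-].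
  by rewrite ler_sqr ?nnegrE ?rnorm_ge0// nilpotent_isometry_le//; exact: AP.
have e20 : 0 < e ^+ 2 by rewrite exprn_gt0.
have [_ [n An <-] Sn] := sup_adherent e20 Ssup.
exists (n u), n => // m [Am nm] /=.
rewrite -ltr_sqr ?nnegrE ?rnorm_ge0 ?(ltW e0)// (extends_dist _ (AP An) nm).
have : rnorm (m u) ^+ 2 <= sup S by apply: ub_le_sup; [exact: Ssup.2|exists m].
by move: Sn; lra.
Qed.

(** The bound is the strong limit [L] of the chain. Equations that hold on a tail pass to [L] when
    they are linear in the moving operator; [L * adjoint L * L = L] is not, and is reduced to
    members of [A] by [dense]. *)
Lemma chain_upper_bound : exists2 l, nilpotent_isometry l &
  forall n, A n -> extends n l.
Proof.
have FF := chain_filter_proper; set F := chain_filter in FF *.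
have /choice[l ml] := chain_cvg; rewrite -/F in ml.
have ll : linear l.
  move=> a u v; apply: (hilbert_cvg_unique (ml _)).
  have -> : (fun m : 'B(H) => m (a *: u + v)) = a \*: (fun m => m u) + (fun m
    => m v).
    by apply/funext => m; exact: linearP.
  exact: (cvgD (cvgZl_tmp (k := a) (ml u)) (ml v)).
have lb u : rnorm (l u) <= 1 * rnorm u.
  rewrite mul1r; apply/ler_addgt0Pl => e e0.
  have /cvg_rnormP/(_ _ e0)[n An nl] := ml u.
  have := nl n (conj An (extends_refl (AP An))) => /= le.
  have := rnormD (l u - n u) (n u); rewrite subrK.
  by have := nilpotent_isometry_le u (AP An); lra.
pose L := BoundedOperator (bounded_linear_rnorm ll lb).
have mL u : (fun m : 'B(H) => m u) @ F --> L u by exact: ml.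
have cstE n (f : 'B(H) -> H) (w z : H) : A n -> f @ F --> w ->
    (forall m, A m -> extends n m -> f m = z) -> w = z.
  move=> An fw fz; apply: (hilbert_cvg_unique fw).
  apply: cvg_near_cst.
  by exists n => // m [Am nm]; exact: fz.
have Lp n : A n -> L * (adjoint n * n) = n.
  move=> An; apply: bopP => u; apply: (cstE _ _ _ _ An (mL _)) => m Am [mn _].
  by rewrite -[LHS]/((m * (adjoint n * n)) u) mn.
have rL n : A n -> n * adjoint n * L = n.
  move=> An; apply: bopP => u; rewrite -[LHS]/((n * adjoint n) (L u)).
  apply: (cstE _ _ _ _ An (bop_cvg (x := n * adjoint n) (mL u))) => m Am [_ nm].
  by rewrite -[LHS]/((n * adjoint n * m) u) nm.
have Ln n : A n -> L * n = 0.
  move=> An; apply: bopP => u; apply: (cstE _ _ _ _ An (mL _)) => m Am [mn _].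
  by rewrite -[LHS]/((m * n) u) -mn mulrA (AP Am).1 mul0r.
have dense x : (forall n, A n -> x * n = 0) -> x * L = 0.
  move=> xn; apply: bopP => u; have [n An] := A0; rewrite -[LHS]/(x (L u)).
  apply: (cstE _ _ _ _ An (bop_cvg (x := x) (mL u))) => m Am _.
  by rewrite -[LHS]/((x * m) u) xn.
exists L; last by move=> n An; split; [exact: Lp|exact: rL].
split; first exact: dense.
(* [L * adjoint L - 1] kills each [n] in [A], since [L * (adjoint L * n) = L * (adjoint n * n) =
   n]. *)
apply/eqP; rewrite -subr_eq0 -[X in _ - X]mul1r -mulrBl; apply/eqP/dense => n
  An.
have LaE : adjoint L * n = adjoint n * n.
  by apply: extends_mul; [exact: AP|split; [exact: Lp|exact: rL]].
by rewrite mulrBl mul1r -mulrA LaE Lp// subrr.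
Qed.

End Chain.

Lemma maximal_nilpotent_isometry : exists2 n, nilpotent_isometry n &
  forall m, nilpotent_isometry m -> extends n m -> extends m n.
Proof.
have iso0 : nilpotent_isometry 0 by split; rewrite !mul0r.
pose T := {n : 'B(H) | nilpotent_isometry n}.
pose Rel (s t : T) := `[< extends (sval s) (sval t) >].
have [||A Atot|[n nP] nmax] := @ZL_preorder T (exist _ 0 iso0) Rel.
- by move=> [n nP]; apply/asboolP/extends_refl.
- move=> [n nP] [m mP] [k kP] /asboolP nm /asboolP mk; apply/asboolP.
  exact: extends_trans nm mk.
(* The empty chain is bounded by the zero operator. *)
- have [[s0 As0]|A0] := pselect (A !=set0); last first.
    by exists (exist _ 0 iso0) => s As; case: A0; exists s.
  have [|||l lP Al] := @chain_upper_bound [set sval s | s in A].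
  + by exists (sval s0), s0.
  + by move=> _ [[n nP] _ <-].
  + move=> _ _ [s As <-] [t At <-].
    by have [/asboolP|/asboolP] := Atot s t As At; [left|right].
  by exists (exist _ l lP) => s As; apply/asboolP/Al; exists s.
exists n => // m mP nm.
by have /asboolP := nmax (exist _ m mP) (asboolT nm).
Qed.

End PartialIsometries.

(** * Two complementary projections factoring through each other *)

Section Halving.
Context {R : realType} {H : hilbertType R}.
Implicit Types (n m x y : 'B(H)) (u v w : H).

Lemma exists_unit x u : x u != 0 -> exists2 w : H, inner w w = 1 & exists v, w
  = x v.
Proof.
move=> xu0; exists ((rnorm (x u))^-1%:C *: x u); first exact: unit_vector.
by exists ((rnorm (x u))^-1%:C *: u); rewrite linearZ.
Qed.

(* Otherwise n + rank_one v u would be a proper extension of n. *)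
Lemma maximal_defect n : nilpotent_isometry n ->
  (forall m, nilpotent_isometry m -> extends n m -> extends m n) ->
  forall u v, n u = 0 -> adjoint n u = 0 -> n v = 0 -> adjoint n v = 0 ->
  inner u u = 1 -> inner v v = 1 -> inner u v <> 0.
Proof.
move=> [nn nnn] nmax u v nu au nv av uu vv uv.
have vu : inner v u = 0 by rewrite innerC uv conjc0.
have [k kE] : exists k, k = rank_one v u by exists (rank_one v u).
have kaE : adjoint k = rank_one u v by rewrite kE adjoint_rank_one.
have nk : n * k = 0 by rewrite kE mul_rank_one nv rank_one0l.
have ank : adjoint n * k = 0 by rewrite kE mul_rank_one av rank_one0l.
have kn : k * n = 0 by rewrite kE rank_one_mul au rank_one0r.
have kan : k * adjoint n = 0 by rewrite kE rank_one_mul adjointK nu rank_one0r.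
have nak : n * adjoint k = 0 by rewrite kaE mul_rank_one nu rank_one0l.
have akn : adjoint k * n = 0 by rewrite kaE rank_one_mul av rank_one0r.
have kk : k * k = 0 by rewrite {2}kE mul_rank_one kE rank_oneE vu scale0r
  rank_one0l.
have kkk : k * adjoint k * k = k.
  by rewrite {3}kE mul_rank_one -[_ v]/(k (adjoint k v)) kaE rank_oneE vv
    scale1r kE rank_oneE uu scale1r.
pose m := n + k.
have mP : nilpotent_isometry m.
  split; first by rewrite /m mulrDl !mulrDr nn nk kn kk !addr0.
  rewrite /m adjointD (mulrDl n) !(mulrDr n) (mulrDr k) nak kan addr0 add0r.
  rewrite mulrDl !mulrDr nnn kkk -!(mulrA _ _ k) -!(mulrA _ _ n) ank akn.
  by rewrite !mulr0 addr0 add0r.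
have nm : extends n m.
  split; first by rewrite /m mulrDl !mulrA nnn kan mul0r addr0.
  by rewrite /m mulrDr nnn -mulrA ank mulr0 addr0.
(* [m] sends [u] to [v] and [adjoint m] sends [v] back to [u], so if [n] extended [m] then
   [v = n u = 0]. *)
have [/(congr1 (fun x : 'B(H) => x u)) + _] := nmax _ mP nm.
have mu : m u = v by rewrite -[LHS]/(n u + k u) nu add0r kE rank_oneE uu
  scale1r.
have amv : adjoint m v = u.
  by rewrite /m adjointD -[LHS]/(adjoint n v + adjoint k v) av add0r kaE
    rank_oneE vv scale1r.
rewrite -[LHS]/(n (adjoint m (m u))) mu amv nu => v0.
by move/eqP: vv; rewrite -v0 inner0l eq_sym oner_eq0.
Qed.

(** [p = adjoint n * n] factors through [1 - p] by [n], and [1 - p] is [n * adjoint n] plus a defect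
    [q] of rank at most one. If [q] projects onto the line of [w], it factors through [p] by way of
    a unit vector [h] in the range of [p]. *)
Lemma exists_halving : dim_ge 2 H -> exists p : 'B(H), [/\ projection p,
  factors_through p (1 - p) & factors_through (1 - p) p].
Proof.
move=> [e eP].
have [n nP nmax] := @maximal_nilpotent_isometry R H.
have [nn nnn] := nP.
have aa : adjoint n * adjoint n = 0 by rewrite -adjointM nn adjoint0.
have ana : adjoint n * n * adjoint n = adjoint n.
  by have /(congr1 adjoint) := nnn; rewrite !adjointM adjointK mulrA.
have [p pE] : exists p, p = adjoint n * n by exists (adjoint n * n).
have pp : projection p.
  by split; rewrite pE; [rewrite mulrA ana|rewrite adjointM adjointK].
have np : n * p = n by rewrite pE mulrA.
have pn : p * n = 0 by rewrite pE -mulrA nn mulr0.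
have pa : p * adjoint n = adjoint n by rewrite pE ana.
have ap : adjoint n * p = 0 by rewrite pE mulrA aa mul0r.
have nP1 : in_corner (1 - p) p n.
  by split=> //; rewrite mulrBl mul1r pn subr0.
have aP1 : in_corner p (1 - p) (adjoint n).
  by split=> //; rewrite mulrBr mulr1 ap subr0.
have zP x y : in_corner x y 0 by split; rewrite ?mulr0 ?mul0r.
exists p; split=> //.
  by exists (adjoint n), n, 0, 0; split=> //; rewrite mulr0 addr0.
(* [q] is the projection onto the common kernel of [n] and [adjoint n]. *)
have [q qE] : exists q, q = 1 - p - n * adjoint n by exists (1 - p - n *
  adjoint n).
have nq : n * q = 0 by rewrite qE !mulrBr mulr1 np subrr mulrA nn mul0r subr0.
have aq : adjoint n * q = 0.
  by rewrite qE !mulrBr mulr1 ap subr0 mulrA ana subrr.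
have qa : adjoint q = q.
  by rewrite qE !adjointB adjoint1 pp.2 adjointM adjointK.
have nqu u : n (q u) = 0 by rewrite -[LHS]/((n * q) u) nq.
have aqu u : adjoint n (q u) = 0 by rewrite -[LHS]/((adjoint n * q) u) aq.
have qq : q * q = q.
  by rewrite {1}qE !mulrBl mul1r pE -!mulrA nq aq !mulr0 !subr0.
have [q0|q0] := pselect (forall u, q u = 0).
  exists n, (adjoint n), 0, 0; split=> //; rewrite mulr0 addr0.
  have : q = 0 by apply: bopP.
  by rewrite qE => /eqP; rewrite subr_eq0 => /eqP.
have [u qu] : exists u, q u != 0.
  by apply: contrapT => h; apply: q0 => u; apply/eqP; apply: contrapT => /negP
    qu; apply: h; exists u.
have [w ww [w' wE]] := exists_unit qu.
have nw : n w = 0 by rewrite wE.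
have aw : adjoint n w = 0 by rewrite wE.
have qw : q w = w by rewrite wE -[LHS]/((q * q) w') qq.
(* A unit vector in the range of [q - rank_one w w] would lie in both kernels and be orthogonal to
   [w], against maximality. *)
have qrank : q = rank_one w w.
  apply: bopP => y; rewrite rank_oneE; apply/eqP; rewrite -subr_eq0; apply/negP
    => /negP z0.
  pose x := q - rank_one w w.
  have xq : x = q * x by rewrite /x mulrBr qq mul_rank_one qw.
  have [z zz [y' zE]] := exists_unit (x := x) z0.
  apply: (maximal_defect nP nmax (u := z) (v := w)) => //.
  - by rewrite zE xq; exact: nqu.
  - by rewrite zE xq; exact: aqu.
  - rewrite zE /x -[(q - _) y']/(q y' - inner y' w *: w) innerDl -scaleN1r
    !innerZl ww.
    by rewrite adjointP qa qw mulN1r mulr1 subrr.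
(* If [n = 0] then [q = 1] and every vector is a multiple of [w], against [dim_ge 2 H]. *)
have [v nv] : exists v, n v != 0.
  apply: contrapT => h.
  have n0 : n = 0.
    by apply: bopP => v; apply/eqP; apply: contrapT => /negP nv; apply: h;
      exists v.
  have eE i : e i = inner (e i) w *: w.
    rewrite -rank_oneE -qrank qE pE n0 mulr0 mul0r !subr0; exact: erefl.
  (* Any two multiples of [w] satisfy this relation. Independence makes its coefficients vanish, so
     [e ord0 = 0], which independence also excludes. *)
  have s0 : inner (e ord_max) w *: e ord0 - inner (e ord0) w *: e ord_max = 0.
    set a := inner _ _; set b := inner _ _.
    by rewrite (eE ord0) (eE ord_max) -/a -/b !scalerA mulrC subrr.
  have e00 : e ord0 = 0.
    have := eP (fun i => if i == ord0 then inner (e ord_max) w else - inner (e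
      ord0) w).
    rewrite big_ord_recl big_ord1 /= (_ : lift _ _ = ord_max); last exact:
      val_inj.
    rewrite scaleNr => /(_ s0 ord_max)/eqP /=.
    by rewrite oppr_eq0 => /eqP e0w; rewrite eE e0w scale0r.
  have := eP (fun i => if i == ord0 then 1 else 0).
  rewrite big_ord_recl big_ord1 /= e00 scaler0 scale0r addr0.
  by move=> /(_ erefl ord0)/eqP; rewrite /= oner_eq0.
have pv : p v != 0.
  by apply: contraNneq nv => pv0; rewrite -np -[(n * p) v]/(n (p v)) pv0
    linear0.
have [h hh [y' hE]] := exists_unit pv.
have ph : p h = h by rewrite hE -[LHS]/((p * p) y') pp.1.
have pw : (1 - p) w = w.
  by rewrite -[LHS]/(w - p w) pE -[X in w - X]/(adjoint n (n w)) nw linear0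
    subr0.
exists n, (adjoint n), (rank_one w h), (rank_one h w); split=> //.
- split; split.
  + by rewrite mul_rank_one pw.
  + by rewrite rank_one_mul pp.2 ph.
  + by rewrite mul_rank_one ph.
  + by rewrite rank_one_mul adjointB adjoint1 pp.2 pw.
- by rewrite mul_rank_one rank_oneE hh scale1r -qrank qE [RHS]addrC subrK.
Qed.

End Halving.

Theorem proposition2p7 (R : realType) (m : nat) (hm : (2 <= m)%N)
    (H : hilbertType R) (dimH : dim_ge 2 H)
    (X : topologicalLmodType R[i]) (hausdorffX : hausdorff_space X)
    (P : 'B(H) -> X) (continuousP : continuous P)
    (polynomialP : homogeneous_polynomial m P)
    (additiveP : orthogonally_additive P) :
  forall x : 'B(H), P x = 0.
Proof.
move=> x; have [phi phiP Pphi] := polynomialP.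
have PE : P = fun y => phi (fun=> y) by apply/funext.
rewrite PE in additiveP *.
have [p [pp pq qp]] := exists_halving dimH.
exact: (halving_eq0 phiP hm additiveP x pp pq qp shift_invertible).
Qed.
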